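(* Let $L$ be a finite-dimensional solvable Leibniz $A$-algebra over a field $F$. Then $Z(L)\cap L^2=0$.
   Context: A (right) Leibniz algebra over $F$ is a vector space with a bilinear product $[\,,]$ satisfying $[x,[y,z]]=[[x,y],z]-[[x,z],y]$ for all $x,y,z$. $L^1=L$, $L^{k+1}=[L^k,L]$, so $L^2=[L,L]$; $L$ is nilpotent if $L^k=0$ for some $k$. Derived series: $L^{(0)}=L$, $L^{(k+1)}=[L^{(k)},L^{(k)}]$; $L$ is solvable if $L^{(k)}=0$ for some $k$. $L$ is abelian if $[x,y]=0$ for all $x,y$. $L$ is an $A$-algebra if every nilpotent subalgebra of $L$ is abelian. The centre is $Z(L)=\{z\in L : [z,x]=[x,z]=0 \text{ for all } x\in L\}$. *)

(* Defs.v *)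
From HB Require Import structures.
From mathcomp Require Import all_boot all_order all_algebra.

Set Implicit Arguments.
Unset Strict Implicit.
Unset Printing Implicit Defensive.

Import GRing.Theory.
Local Open Scope ring_scope.

(* Finite-dimensional right Leibniz algebras: finite dimension comes from     *)
(* the vectType structure.                                                    *)
HB.mixin Record Vector_isLeibniz (F : fieldType) L of Vector F L := {
  bracket : L -> L -> L;
  bracket_linearr : forall x, linear (bracket x);
  bracket_linearl : forall y, linear (bracket^~ y);
  bracket_leibniz : forall x y z,
    bracket x (bracket y z)
    = bracket (bracket x y) z - bracket (bracket x z) y
}.

#[short(type="leibnizType")]
HB.structure Definition Leibniz (F : fieldType) :=
  {L of Vector F L & Vector_isLeibniz F L}.

Section Leibniz.

Variables (F : fieldType) (L : leibnizType F).
Implicit Types (U V W : {vspace L}) (x y z : L).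

HB.instance Definition _ x :=
  GRing.isLinear.Build F L L *:%R (bracket x) (bracket_linearr x).

Definition rbracket y x : L := bracket x y.

HB.instance Definition _ y :=
  GRing.isLinear.Build F L L *:%R (rbracket y) (bracket_linearl y).

(* [U, V], the span of all products; as for prodv in falgebra, a basis of each *)
(* factor suffices (see bracketvP).                                           *)
Definition bracketv U V : {vspace L} :=
  <<[seq bracket u v | u <- vbasis U, v <- vbasis V]>>%VS.

Lemma mem_bracketv U V : {in U & V, forall u v, bracket u v \in bracketv U V}.
Proof.
move=> u v /coord_vbasis-> /coord_vbasis->; rewrite linear_sum memv_suml // => j _.
rewrite linearZ memvZ //= -/(rbracket _ _) linear_sum memv_suml // => i _.
rewrite linearZ memvZ // memv_span //.
by apply/allpairsP; exists ((vbasis U)`_i, (vbasis V)`_j); rewrite !memt_nth.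
Qed.

Lemma bracketvP U V W :
  reflect {in U & V, forall u v, bracket u v \in W} (bracketv U V <= W)%VS.
Proof.
apply: (iffP idP) => [/subvP sUVW u v Uu Vv | sUVW].
  by rewrite sUVW ?mem_bracketv.
apply/span_subvP=> _ /allpairsP[[u v] /= [Uu Vv ->]].
by rewrite sUVW ?vbasis_mem.
Qed.

Definition subalgebra U := (bracketv U U <= U)%VS.

(* Indices are shifted: lower_central U k is U^(k+1), so lower_central U 0    *)
(* is U^1 = U.                                                                *)
Fixpoint lower_central U (k : nat) : {vspace L} :=
  if k is k'.+1 then bracketv (lower_central U k') U else U.

Fixpoint derived U (k : nat) : {vspace L} :=
  if k is k'.+1 then bracketv (derived U k') (derived U k') else U.

Definition nilpotent U : Prop := exists k, lower_central U k = 0%VS.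

Definition solvable U : Prop := exists k, derived U k = 0%VS.

Definition abelian U : Prop := {in U &, forall x y, bracket x y = 0}.

Definition centre : {vspace L} :=
  (\bigcap_(x <- vbasis {:L})
     (lker (linfun (bracket x)) :&: lker (linfun (rbracket x))))%VS.

Lemma centreP z :
  reflect (forall x, bracket z x = 0 /\ bracket x z = 0) (z \in centre).
Proof.
rewrite /centre big_tnth memvE; apply: (iffP subv_bigcapP) => [cz x | cz i _].
  have {}cz i : bracket z (vbasis {:L})`_i = 0 /\ bracket (vbasis {:L})`_i z = 0.
    have [i_lt | i_ge] := ltnP i (size (vbasis {:L})); last first.
      by rewrite nth_default // linear0 -/(rbracket z 0) linear0.
    have := cz (Ordinal i_lt) isT.
    rewrite -memvE memv_cap !memv_ker !lfunE /= (tnth_nth 0) /=.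
    by case/andP=> /eqP-> /eqP.
  rewrite (coord_vbasis (memvf x)); split.
    by rewrite linear_sum big1 // => i _; rewrite linearZ /= (cz i).1 scaler0.
  rewrite -/(rbracket z _) linear_sum big1 // => i _.
  by rewrite linearZ /= /rbracket (cz i).2 scaler0.
rewrite -memvE memv_cap !memv_ker !lfunE /= /rbracket.
by rewrite (cz _).1 (cz _).2 eqxx.
Qed.

End Leibniz.

Definition A_algebra (F : fieldType) (L : leibnizType F) : Prop :=
  forall U : {vspace L}, subalgebra U -> nilpotent U -> abelian U.

Arguments centre {F} L.

(* Main.v *)
(* Write M^2 = [M, M]. The key fact is that M^2 = [M^2, M] for every subalgebra
   M. As M / [M^2, M] is nilpotent, a minimal subalgebra U supplementing
   [M^2, M] in M is nilpotent by Engel's theorem, hence abelian, which forces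
   M^2 into [M^2, M].
   Now M^2 / [M^2, M^2] is a module over commuting right multiplications by M,
   and it equals its own product with M, so it has no nonzero vector killed by
   M. Hence any z in M^2 killed by M lies in [M^2, M^2], and descending along
   the derived series gives z = 0. *)
Require Import Defs.
From mathcomp Require Import all_boot all_order all_algebra.

Set Implicit Arguments.
Unset Strict Implicit.
Unset Printing Implicit Defensive.

Import GRing.Theory.
Local Open Scope ring_scope.

(** * Stationary chains of subspaces and Fitting's decomposition *)

Lemma bounded_nat_seq_descent (a : nat -> nat) (d : nat) :
  (forall n, a n <= d)%N -> exists n, (a n.+1 <= a n)%N.
Proof.
move=> a_le; case: (boolP (has (fun n => a n.+1 <= a n)%N (iota 0 d.+1))).
  by case/hasP=> n _ le_a; exists n.
move/hasPn=> a_lt.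
have a_ge n : (n <= d.+1)%N -> (n <= a n)%N.
  elim: n => // n IHn ltn; apply: leq_ltn_trans (IHn (ltnW ltn)) _.
  by rewrite ltnNge a_lt // mem_iota.
by have:= leq_trans (a_ge _ (leqnn _)) (a_le _); rewrite ltnn.
Qed.

Section LinearAlgebra.

Variables (F : fieldType) (L : vectType F).
Implicit Types (f : 'End(L)) (C U V W : {vspace L}).

Lemma increasing_chain_stable (W : nat -> {vspace L}) :
  (forall n, W n <= W n.+1)%VS -> exists n, W n.+1 = W n.
Proof.
move=> W_incr; have [n leW] : exists n, (\dim (W n.+1) <= \dim (W n))%N.
  apply: (@bounded_nat_seq_descent _ (\dim {:L})) => n.
  by rewrite dimvS ?subvf.
by exists n; apply/esym/eqP; rewrite eqEdim W_incr.
Qed.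

Lemma decreasing_chain_stable (W : nat -> {vspace L}) :
  (forall n, W n.+1 <= W n)%VS -> exists n, W n.+1 = W n.
Proof.
move=> W_decr.
have [n leW] :=
  bounded_nat_seq_descent (fun n => leq_subr (\dim (W n)) (\dim {:L})).
exists n; apply/eqP; rewrite eqEdim W_decr /=.
have: (\dim (W n) <= \dim {:L})%N by rewrite dimvS ?subvf.
have: (\dim (W n.+1) <= \dim {:L})%N by rewrite dimvS ?subvf.
by move=> le1 le0; rewrite -(leq_sub2lE _ le0).
Qed.

(** Kept in ['End(L)], so that kernels, images and preimages of powers are subspaces. *)
Definition lfun_pow f n : 'End(L) := iter n (comp_lfun f) \1%VF.

Lemma lfun_powE f n v : lfun_pow f n v = iter n f v.
Proof. by elim: n => [|n IHn]; rewrite /= ?id_lfunE // comp_lfunE IHn. Qed.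

Lemma lfun_powS f n v : lfun_pow f n.+1 v = f (lfun_pow f n v).
Proof. by rewrite !lfun_powE. Qed.

Lemma lfun_powSr f n v : lfun_pow f n.+1 v = lfun_pow f n (f v).
Proof. by rewrite !lfun_powE iterSr. Qed.

Lemma lfun_powD f m n v : lfun_pow f (m + n) v = lfun_pow f m (lfun_pow f n v).
Proof. by rewrite !lfun_powE iterD. Qed.

Lemma lfun_pow_stable f W n v :
  {in W, forall w, f w \in W} -> v \in W -> lfun_pow f n v \in W.
Proof.
by move=> fW Wv; elim: n => [|n IHn]; rewrite ?lfun_powS ?fW // lfun_powE.
Qed.

Lemma iter_stable_ge T (g : T -> T) x n m :
  iter n.+1 g x = iter n g x -> (n <= m)%N -> iter m g x = iter n g x.
Proof. by move=> gx /subnK <-; rewrite iterD iter_fix. Qed.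

(* Fitting's decomposition of [V / C] with respect to [f]: the kernel and the
   image of [f ^ m] meet trivially, and together they span. *)
Lemma fitting f V C :
    (C <= V)%VS ->
    {in V, forall v, f v \in V} -> {in C, forall v, f v \in C} ->
  exists n, forall m, (n <= m)%N ->
    (forall v, lfun_pow f (m + m) v \in C -> lfun_pow f m v \in C) /\
    {in V, forall v,
      exists2 w, w \in V & lfun_pow f m v - lfun_pow f (m + m) w \in C}.
Proof.
move=> sCV fV fC.
(* Modulo [C], [K n] is the kernel of [f ^ n] and [I n] its image. Each is the orbit of a single
   map, so one repetition makes it constant from there on. *)
pose K n := iter n (fun W => f @^-1: W)%VS C.
pose I n := iter n (fun W => f @: W + C)%VS V.
have memK n v : (v \in K n) = (lfun_pow f n v \in C).
  elim: n v => [|n IHn] v; first by rewrite lfun_powE.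
  by rewrite lfun_powSr -IHn memv_preim.
have memI n v : v \in V -> lfun_pow f n v \in I n.
  elim: n v => [|n IHn] v Vv; first by rewrite lfun_powE.
  by rewrite lfun_powS -[f _]addr0 memv_add ?mem0v ?memv_img ?IHn.
have inI n u : u \in I n -> exists2 w, w \in V & u - lfun_pow f n w \in C.
  elim: n u => [|n IHn] u; first by exists u; rewrite // lfun_powE subrr mem0v.
  case/memv_addP=> _ /memv_imgP[b /IHn[w Vw Cbw] ->] [c Cc ->]; exists w => //.
  by rewrite lfun_powS addrAC -linearB rpredD ?fC.
have [nK eqK] : exists n, K n.+1 = K n.
  apply: increasing_chain_stable => n; apply/subvP=> v.
  by rewrite !memK lfun_powS; apply: fC.
have [nI eqI] : exists n, I n.+1 = I n.
  apply: decreasing_chain_stable => n; elim: n => [|n IHn] /=.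
    rewrite subv_add sCV andbT; apply/subvP=> _ /memv_imgP[v Vv ->].
    exact: fV.
  by rewrite addvS ?limgS.
exists (maxn nK nI) => m; rewrite geq_max => /andP[leKm leIm].
split=> [v | v Vv].
  rewrite -!memK /K (iter_stable_ge eqK leKm).
  by rewrite (iter_stable_ge eqK) // (leq_trans leKm) ?leq_addr.
apply: inI; rewrite /I (iter_stable_ge eqI) ?(leq_trans leIm) ?leq_addr //.
by rewrite -(iter_stable_ge eqI leIm) memI.
Qed.

End LinearAlgebra.

(** * Right multiplications, solvability and Engel's theorem *)

Section LeibnizAlgebra.

Variables (F : fieldType) (L : leibnizType F).
Implicit Types (C J M S T U V W : {vspace L}) (u v w x y z : L).

Lemma bracket0l x : bracket 0 x = 0 :> L.
Proof. exact: (linear0 (rbracket x)). Qed.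

Lemma bracketDl x : {morph (@bracket F L)^~ x : u v / u + v}.
Proof. exact: (linearD (rbracket x)). Qed.

Lemma bracketDr x : {morph @bracket F L x : u v / u + v}.
Proof. exact: (linearD (bracket x)). Qed.

Lemma bracketvS U U' V V' :
  (U <= U' -> V <= V' -> bracketv U V <= bracketv U' V')%VS.
Proof.
move=> /subvP sU /subvP sV; apply/bracketvP=> u v /sU Uu /sV Vv.
exact: mem_bracketv.
Qed.

Definition right_mul x : 'End(L) := linfun (rbracket x).

Lemma right_mulE x u : right_mul x u = bracket u x.
Proof. by rewrite lfunE. Qed.

Lemma right_mul_derivation x u v :
  right_mul x (bracket u v)
  = bracket u (right_mul x v) + bracket (right_mul x u) v.
Proof. by rewrite !right_mulE bracket_leibniz subrK. Qed.

Lemma derivedS U V k : (U <= V -> derived U k <= derived V k)%VS.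
Proof. by move=> sUV; elim: k => //= k IHk; apply: bracketvS. Qed.

Lemma derived_bracketv U k : derived (bracketv U U) k = derived U k.+1.
Proof. by elim: k => //= k ->. Qed.

Lemma solvableS U V : (U <= V)%VS -> solvable V -> solvable U.
Proof.
move=> sUV [k Vk0]; exists k; apply/eqP.
by rewrite -subv0 -Vk0 derivedS.
Qed.

Lemma solvable_bracketv_neq S : solvable S -> S != 0%VS -> bracketv S S != S.
Proof.
case=> k Sk0; apply: contraNneq => eqS; rewrite -Sk0.
by have ->: derived S k = S by elim: k {Sk0} => //= k ->.
Qed.

(** Solvability gives [y] in [S] outside [[S, S]]. As every subspace between [[S, S]] and [S] is an
    ideal of [S], the induction in [engel] can pass to [T]. *)
Lemma solvable_hyperplane S :
    subalgebra S -> solvable S -> S != 0%VS ->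
  exists T y, [/\ (bracketv S S <= T)%VS, (T <= S)%VS, (\dim T < \dim S)%N,
                  y \in S & (S <= T + <[y]>)%VS].
Proof.
move=> algS solS S0; have:= solvable_bracketv_neq solS S0.
have algS' : (bracketv S S <= S)%VS := algS.
rewrite eqEsubv algS' /= => /subvPn[y Sy S'y].
have sXS : (bracketv S S + <[y]> <= S)%VS by rewrite subv_add algS' -memvE.
exists (bracketv S S + (S :\: (bracketv S S + <[y]>)))%VS, y; split=> //.
- exact: addvSl.
- by rewrite subv_add algS' diffvSl.
- have:= dimv_cap_compl S (bracketv S S + <[y]>); rewrite (capv_idPr sXS) => <-.
  apply: leq_ltn_trans (dimv_add_leqif _ _) _; rewrite ltn_add2r ltnNge.
  apply: contra S'y => ledim; have: (bracketv S S + <[y]> <= bracketv S S)%VS.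
    by rewrite -(geq_leqif (dimv_leqif_sup (addvSl _ _))).
  by move/(subv_trans (addvSr _ _)); rewrite -memvE.
- by rewrite [(_ + (S :\: _))%VS]addvC -addvA addv_diff addvSl.
Qed.

(* Engel's theorem for the [S]-module [V / C], in dual form: a nonzero module on
   which [S] acts by nilpotent operators satisfies [V S != V]. *)
Lemma engel S V C :
    subalgebra S -> solvable S ->
    (C <= V)%VS -> (bracketv V S <= V)%VS -> (bracketv C S <= C)%VS ->
    {in S, forall x,
      exists n, {in V, forall v, lfun_pow (right_mul x) n v \in C}} ->
    (V <= bracketv V S + C)%VS ->
  (V <= C)%VS.
Proof.
move: {2}(\dim S).+1 (ltnSn (\dim S)) => d.
elim: d S => // d IHd S leSd algS solS sCV sVSV sCSC nilS sV.
have [S0 | S0] := eqVneq S 0%VS.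
  apply: subv_trans sV _; rewrite subv_add subvv andbT.
  apply/bracketvP=> v x Vv; rewrite S0 memv0 => /eqP->.
  by rewrite linear0 mem0v.
have [T [y [sSST sTS ltTS Sy sST]]] := solvable_hyperplane algS solS S0.
(* After the side conditions it remains to show that [V] lies in [[V, T] + C]. *)
apply: (IHd T) => //.
- exact: leq_trans ltTS _.
- exact: subv_trans (bracketvS sTS sTS) sSST.
- exact: solvableS solS.
- exact: subv_trans (bracketvS (subvv _) sTS) sVSV.
- exact: subv_trans (bracketvS (subvv _) sTS) sCSC.
- by move=> x /(subvP sTS)/nilS.
set W := (bracketv V T + C)%VS.
have VS v x : v \in V -> x \in S -> bracket v x \in V.
  by move=> Vv Sx; apply: (subvP sVSV); apply: mem_bracketv.
(* [[[v, t], y] = [v, [t, y]] + [[v, y], t]], where [[t, y]] is in [[S, S]], hence in [T]. *)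
have Wy w : w \in W -> right_mul y w \in W.
  suff: (W <= right_mul y @^-1: W)%VS.
    by move/subvP=> sW /sW; rewrite memv_preim.
  rewrite {1}/W subv_add; apply/andP; split.
    apply/bracketvP=> v t Vv Tt.
    rewrite -memv_preim right_mul_derivation !right_mulE.
    apply: (subvP (addvSl _ _)); rewrite rpredD ?mem_bracketv ?VS //.
    by apply: (subvP sSST); rewrite mem_bracketv // (subvP sTS).
  apply/subvP=> c Cc; rewrite -memv_preim right_mulE.
  apply: (subvP (addvSr _ _)); apply: (subvP sCSC); exact: mem_bracketv.
have [n nil_y] := nilS y Sy.
(* Modulo [W], [V = V y], so [V = V y^k] for all [k]; but [y] acts nilpotently modulo [C]. *)
have sVW k v : v \in V ->
    exists2 u, u \in V & v - lfun_pow (right_mul y) k u \in W.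
  elim: k v => [|k IHk] v Vv.
    by exists v; rewrite // lfun_powE subrr mem0v.
  have {IHk}[u Vu Wvu] := IHk v Vv.
  have sVy : (V <= right_mul y @: V + W)%VS.
    apply: subv_trans sV _; rewrite subv_add.
    rewrite (subv_trans (addvSr _ _) (addvSr _ _)) andbT.
    apply/bracketvP=> a x Va /(subvP sST)/memv_addP[t Tt [_ /vlineP[c ->] ->]].
    rewrite bracketDr linearZ /= addrC memv_add //.
      by rewrite -right_mulE rpredZ ?memv_img.
    by apply: (subvP (addvSl _ _)); apply: mem_bracketv.
  have /memv_addP[_ /memv_imgP[b Vb ->] [w Ww def_u]] := subvP sVy u Vu.
  exists b => //; have -> : v - lfun_pow (right_mul y) k.+1 b
      = v - lfun_pow (right_mul y) k u + lfun_pow (right_mul y) k w.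
    by rewrite lfun_powSr def_u linearD opprD -!addrA addNr addr0.
  by rewrite rpredD // lfun_pow_stable.
apply/subvP=> v /(sVW n)[u Vu Wvu].
rewrite -(subrK (lfun_pow (right_mul y) n u) v) rpredD //.
by apply: (subvP (addvSr _ _)); apply: nil_y.
Qed.

(** The lower central series becomes stationary at some [V = [V, U]], and [engel] with [C = 0] gives
    [V = 0]. *)
Lemma nilpotent_of_nil U :
    subalgebra U -> solvable U ->
    {in U, forall x,
      exists n, {in U, forall v, lfun_pow (right_mul x) n v = 0}} ->
  nilpotent U.
Proof.
move=> algU solU nilU.
have lc_decr k : (lower_central U k.+1 <= lower_central U k)%VS.
  elim: k => [|k IHk]; first exact: algU.
  exact: bracketvS.
have lcU k : (lower_central U k <= U)%VS.
  by elim: k => [|k IHk]; rewrite ?subvv // (subv_trans (lc_decr k)).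
have [k lck] := decreasing_chain_stable lc_decr.
exists k; apply/eqP; rewrite -subv0; apply: (engel algU solU) => //.
- exact: sub0v.
- exact: lc_decr.
- by apply/bracketvP=> u v; rewrite memv0 => /eqP-> _; rewrite bracket0l mem0v.
- move=> x /nilU[n nil_x]; exists n => v /(subvP (lcU k))/nil_x->.
  exact: mem0v.
- by rewrite addv0 -/(lower_central U k.+1) lck.
Qed.

(** * Fitting null components of right multiplications *)

(** In the Leibniz expansion each term hits [u] at least [a] times or [v] at least [b] times. This
    makes the null component in a subalgebra closed under the bracket. *)
Lemma lfun_pow_bracket_eq0 x a b u v n :
    (a + b <= n)%N ->
    lfun_pow (right_mul x) a u = 0 -> lfun_pow (right_mul x) b v = 0 ->
  lfun_pow (right_mul x) n (bracket u v) = 0.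
Proof.
elim: n a b u v => [|n IHn] [|a] b u v leab.
- by rewrite [lfun_pow _ 0 u]lfun_powE /= => -> _; rewrite bracket0l linear0.
- by [].
- by rewrite [lfun_pow _ 0 u]lfun_powE /= => -> _; rewrite bracket0l linear0.
case: b leab => [|b] leab u0 v0.
  by rewrite lfun_powE /= in v0; rewrite v0 !linear0.
rewrite lfun_powSr right_mul_derivation linearD /=.
rewrite (IHn a.+1 b) ?(IHn a b.+1) ?addr0 -?lfun_powSr //.
by rewrite -ltnS -addnS.
Qed.

(* A form of Nakayama's lemma: a module over a commutative family of operators
   such that [V = V M] contains no nonzero vector killed by [M]. Everything is
   read modulo [C]. If all of [M] is nil then Engel's theorem gives [V = C];
   otherwise [V] can be replaced by a smaller Fitting null component. *)
Lemma mem_of_bracket_eq0 M V C z :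
    subalgebra M -> solvable M ->
    (C <= V)%VS -> (bracketv V M <= V)%VS -> (bracketv C M <= C)%VS ->
    {in V & M, forall v x, {in M, forall y, bracket v (bracket x y) \in C}} ->
    (V <= bracketv V M + C)%VS ->
    z \in V -> {in M, forall x, bracket z x = 0} ->
  z \in C.
Proof.
move=> algM solM; move: {2}(\dim V).+1 (ltnSn (\dim V)) => d.
elim: d V => // d IHd V leVd sCV sVMV sCMC commV sV Vz zM.
have VM v x : v \in V -> x \in M -> bracket v x \in V.
  by move=> Vv Mx; apply: (subvP sVMV); apply: mem_bracketv.
have CM v x : v \in C -> x \in M -> bracket v x \in C.
  by move=> Cv Mx; apply: (subvP sCMC); apply: mem_bracketv.
apply: contraT => C'z; suff sVC: (V <= C)%VS by rewrite (subvP sVC) in C'z.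
apply: (engel algM solM) => // x Mx.
pose f := right_mul x.
have fV : {in V, forall v, f v \in V}.
  by move=> v Vv; rewrite right_mulE VM.
have fC : {in C, forall v, f v \in C}.
  by move=> v Cv; rewrite right_mulE CM.
have [n fittingV] := fitting sCV fV fC.
(* A positive exponent puts [z], which [x] kills, into the null component [V0]. *)
have {fittingV} := fittingV n.+1 (leqnSn n).
move: (ltn0Sn n); set m := n.+1 => m_gt0; clearbody m => -[kerP imP].
(* Modulo [C], [f] commutes with right multiplication by [y], because [[w, [x, y]]] lies in [C]. *)
have fpowC k v y : v \in V -> y \in M ->
    lfun_pow f k (bracket v y) - bracket (lfun_pow f k v) y \in C.
  move=> Vv My; elim: k => [|k IHk]; first by rewrite !lfun_powE subrr mem0v.
  rewrite !lfun_powS [f (lfun_pow f k v)]right_mulE.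
  set w := lfun_pow f k v in IHk *; have Vw : w \in V by apply: lfun_pow_stable.
  have := commV w x Vw Mx y My.
  rewrite bracket_leibniz => Cwxy; have /fC := IHk.
  rewrite linearB /= [f (bracket w y)]right_mulE => Cfw.
  have := rpredB Cfw Cwxy.
  by rewrite opprB addrA subrK.
pose V0 := (V :&: lfun_pow f m @^-1: C)%VS.
have memV0 v : (v \in V0) = (v \in V) && (lfun_pow f m v \in C).
  by rewrite memv_cap memv_preim.
have sV0V : (V0 <= V)%VS by exact: capvSl.
have sCV0 : (C <= V0)%VS.
  apply/subvP=> c Cc; rewrite memV0 (subvP sCV) //=.
  exact: lfun_pow_stable.
have V0M v y : v \in V0 -> y \in M -> bracket v y \in V0.
  rewrite !memV0 => /andP[Vv Cv] My; rewrite VM //=.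
  rewrite -(subrK (bracket (lfun_pow f m v) y) (lfun_pow _ _ _)).
  by rewrite rpredD ?fpowC ?CM.
have V0z : z \in V0.
  by rewrite memV0 Vz -(prednK m_gt0) lfun_powSr right_mulE zM // linear0 mem0v.
pose V1 := (lfun_pow f m @: V)%VS.
have V01C v : v \in V0 -> v \in V1 -> v \in C.
  rewrite memV0 => /andP[_] + /memv_imgP[w Vw def_v].
  by rewrite def_v -lfun_powD => /kerP.
have sV01 : (V <= V0 + V1)%VS.
  apply/subvP=> v Vv; have [w Vw Cvw] := imP v Vv.
  rewrite -(subrK (lfun_pow f m w) v) memv_add ?memv_img // memV0.
  rewrite linearB /= -lfun_powD Cvw andbT rpredB //.
  exact: lfun_pow_stable.
have sVM : (bracketv V M <= bracketv V0 M + (V1 + C))%VS.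
  apply/bracketvP=> u y /(subvP sV01)/memv_addP[a V0a [b V1b ->]] My.
  have{b V1b} /memv_imgP[w Vw ->] := V1b.
  rewrite bracketDl memv_add ?mem_bracketv //.
  rewrite -[bracket _ y](subKr (lfun_pow f m (bracket w y))).
  by rewrite memv_add ?rpredN ?memv_img ?VM ?fpowC.
(* Splitting [v] in [V0] along [V M = V0 M + V1 M] modulo [C], the part in [V1] is also in [V0],
   hence in [C]. *)
have sV0 : (V0 <= bracketv V0 M + C)%VS.
  apply/subvP=> v V0v.
  have /memv_addP[a /(subvP sVM)/memv_addP[b V0Mb [e Ve def_a]] [c Cc def_v]] :=
    subvP sV v (subvP sV0V v V0v).
  case/memv_addP: Ve def_a => e0 V1e [c' Cc' ->] def_a.
  rewrite def_v def_a -addrA memv_add // rpredD // rpredD //.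
  apply: V01C => //.
  have -> : e0 = v - b - (c' + c).
    rewrite def_v def_a -[b + _ + c]addrA [b + _]addrC addrK.
    by rewrite -[e0 + c' + c]addrA addrK.
  rewrite !rpredB ?rpredD ?(subvP sCV0 _ Cc) ?(subvP sCV0 _ Cc') //.
  by apply: (subvP _ _ V0Mb); apply/bracketvP=> ? ?; apply: V0M.
have [ltV0 | leV0] := ltnP (\dim V0) (\dim V).
  case/negP: C'z; apply: (IHd V0) => //; first exact: leq_trans ltV0 _.
    by apply/bracketvP=> ? ?; apply: V0M.
  by move=> v y /(subvP sV0V) Vv My y' My'; apply: commV.
exists m => v; have /eqP <- : V0 == V by rewrite eqEdim sV0V.
by rewrite memV0 => /andP[].
Qed.

(* If [U] has minimal dimension among the subalgebras supplementing [M^3] in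
   [M], then it is its own Fitting null component for every right multiplication
   by one of its elements, as the other component lies in [M^3]; so [U] is
   nilpotent, hence abelian, and [M^2 <= [U, U] + M^3 = M^3]. *)
Lemma supplement_bracketv_sub M U :
    A_algebra L -> subalgebra M -> solvable M -> subalgebra U ->
    (U <= M)%VS -> (M <= U + bracketv (bracketv M M) M)%VS ->
  (bracketv M M <= bracketv (bracketv M M) M)%VS.
Proof.
move=> AL algM solM; move: {2}(\dim U).+1 (ltnSn (\dim U)) => d.
set J := bracketv (bracketv M M) M.
elim: d U => // d IHd U leUd algU sUM sMUJ; apply: contraT => nJ.
have sMM : (bracketv M M <= M)%VS := algM.
have JM u v : u \in M -> v \in J -> bracket u v \in J.
  move=> Mu; suff: (J <= linfun (bracket u) @^-1: J)%VS.
    by move/subvP=> sJ /sJ; rewrite -memv_preim lfunE.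
  apply/bracketvP=> b y MMb My; rewrite -memv_preim lfunE /= bracket_leibniz.
  by rewrite rpredB ?mem_bracketv ?(subvP sMM b).
have MJ u v : u \in J -> v \in M -> bracket u v \in J.
  move=> Ju Mv; rewrite mem_bracketv //; apply: (subvP _ u Ju).
  exact: bracketvS.
have abU : abelian U.
  apply: AL => //; apply: nilpotent_of_nil => //; first exact: solvableS solM.
  move=> x Ux; pose f := right_mul x.
  have fU : {in U, forall v, f v \in U}.
    by move=> v Uv; rewrite right_mulE (subvP algU) ?mem_bracketv.
  have f0 : {in 0%VS, forall v, f v \in 0%VS}.
    by move=> v; rewrite memv0 => /eqP->; rewrite linear0 mem0v.
  have [n fitU] := fitting (sub0v U) fU f0.
  (* With exponent at least 2, the last two multiplications by [x] send the image of [f ^ m] into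
     [J]. *)
  have {fitU} := fitU n.+2 (leqW (leqnSn n)).
  have : (1 < n.+2)%N by [].
  move: n.+2 => m m_gt1 [kerP imP].
  pose U0 := (U :&: lker (lfun_pow f m))%VS.
  have memU0 v : (v \in U0) = (v \in U) && (lfun_pow f m v == 0).
    by rewrite memv_cap memv_ker.
  have imJ v : v \in U -> lfun_pow f m v \in J.
    move=> Uv; have Mf k : lfun_pow f k v \in M.
      by apply: (subvP sUM); apply: lfun_pow_stable.
    have Mx := subvP sUM x Ux.
    rewrite -(subnK m_gt1) addn2 !lfun_powS !right_mulE.
    by rewrite mem_bracketv ?mem_bracketv.
  have sU0U : (U0 <= U)%VS := capvSl _ _.
  have [ltU0 | leU0] := ltnP (\dim U0) (\dim U).
    case/negP: nJ; apply: (IHd U0) => //.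
    - exact: leq_trans ltU0 _.
    - apply/bracketvP=> u v; rewrite !memU0.
      case/andP=> Uu /eqP u0 /andP[Uv /eqP v0].
      rewrite (subvP algU) ?mem_bracketv //= -memv0; apply: kerP.
      by rewrite (lfun_pow_bracket_eq0 _ u0 v0) ?mem0v.
    - exact: subv_trans sUM.
    apply: subv_trans sMUJ _; rewrite subv_add addvSr andbT.
    apply/subvP=> v Uv; have [w Uw] := imP v Uv; rewrite memv0 => vw0.
    rewrite -(subrK (lfun_pow f m w) v) memv_add ?imJ // memU0.
    rewrite linearB /= -lfun_powD vw0 andbT rpredB //.
    exact: lfun_pow_stable.
  exists m => v; have /eqP <- : U0 == U by rewrite eqEdim sU0U.
  by rewrite memU0 => /andP[_ /eqP].
case/negP: nJ; apply/bracketvP=> u v Mu Mv.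
have /memv_addP[a Ua [b Jb def_u]] := subvP sMUJ u Mu.
have /memv_addP[a' Ua' [b' Jb' def_v]] := subvP sMUJ v Mv.
rewrite def_v bracketDr; apply: rpredD; last exact: JM.
rewrite def_u bracketDl; apply: rpredD; last by rewrite MJ ?(subvP sUM).
by rewrite abU ?mem0v.
Qed.

(** * Descent along the derived series *)

Lemma solvable_A_bracketv_sub M :
    A_algebra L -> subalgebra M -> solvable M ->
  (bracketv M M <= bracketv (bracketv M M) M)%VS.
Proof.
move=> AL algM solM.
exact: (supplement_bracketv_sub AL algM solM algM (subvv _) (addvSl _ _)).
Qed.

(** Stated for subalgebras so that the induction can pass from [M] to [[M, M]]: [mem_of_bracket_eq0]
    with [V = [M, M]] and [C = [V, V]] moves [z] one step down. *)
Lemma solvable_A_left_annihilator M z :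
    A_algebra L -> subalgebra M -> solvable M ->
    z \in bracketv M M -> {in M, forall x, bracket z x = 0} ->
  z = 0.
Proof.
move=> AL algM [k]; elim: k M algM => [|k IHk] M algM Mk0 MMz zM.
  by have:= subvP algM z MMz; rewrite (Mk0 : M = 0%VS) memv0 => /eqP.
have sMM : (bracketv M M <= M)%VS := algM.
have solM : solvable M by exists k.+1.
apply: (IHk (bracketv M M)); first exact: bracketvS.
- by rewrite derived_bracketv.
- apply: (mem_of_bracket_eq0 algM solM _ _ _ _ _ MMz zM).
  + exact: bracketvS.
  + exact: bracketvS.
  + apply/bracketvP=> c x.
    move=> MMc Mx; rewrite -right_mulE memv_preim; apply: (subvP _ c MMc).
    apply/bracketvP=> a b MMa MMb; rewrite -memv_preim right_mul_derivation.
    rewrite !right_mulE.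
    by apply: rpredD; rewrite !mem_bracketv // (subvP sMM).
  (* Right multiplications commute modulo [C], since [v] and [[x, y]] are both in [[M, M]]. *)
  + by move=> v x MMv Mx y My; rewrite !mem_bracketv.
  + exact: (subv_trans (solvable_A_bracketv_sub AL algM solM) (addvSl _ _)).
- by move=> x /(subvP sMM)/zM.
Qed.

End LeibnizAlgebra.

Theorem theorem3p4 (F : fieldType) (L : leibnizType F)
    (solL : solvable {:L}%VS) (AL : A_algebra L) :
  (centre L :&: bracketv {:L} {:L})%VS = 0%VS.
Proof.
apply/eqP; rewrite -subv0; apply/subvP=> z.
rewrite memv_cap memv0 => /andP[/centreP cz L2z]; apply/eqP.
apply: (solvable_A_left_annihilator AL _ solL L2z) => [|x _].
  exact: subvf.
by have [] := cz x.
Qed.
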